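(* Let $(\overline{M},\varphi,\xi,\eta,\overline{g})$ be a Lorentzian para-Sasakian manifold and let $i:M\to\overline{M}$ be a noninvariant hypersurface (with $\xi$ nowhere tangent to $M$), with the induced almost product structure $J$ and induced $1$-form $\alpha$. Then $M$ is a locally product manifold if and only if $$\alpha(Y)JX=\alpha(JY)X\qquad\text{for all }X,Y\in\Gamma(TM).$$
   Context: A $(1,1,1)$ ac structure on an $n$-dimensional differentiable manifold $\overline{M}$ is a triple $(\varphi,\xi,\eta)$ of a $(1,1)$-tensor field, a nowhere vanishing vector field and a $1$-form with $\varphi\xi=0$ and $\varphi^2=I+\eta\otimes\xi$ (hence $\eta\circ\varphi=0$, $\eta(\xi)=-1$). A Lorentzian almost paracontact manifold is a $(1,1,1)$ ac manifold with a Lorentzian metric $\overline{g}$ satisfying $\overline{g}(\overline{X},\xi)=\eta(\overline{X})$ and $\overline{g}(\varphi\overline{X},\varphi\overline{Y})=\overline{g}(\overline{X},\overline{Y})+\eta(\overline{X})\eta(\overline{Y})$. It is Lorentzian para-Sasakian if, with $\overline{\nabla}$ the Levi-Civita connection of $\overline{g}$, $$(\overline{\nabla}_{\overline X}\varphi)\overline Y=\eta(\overline Y)\overline X+\overline g(\overline X,\overline Y)\xi+2\eta(\overline X)\eta(\overline Y)\xi.$$ Let $M$ be an $(n-1)$-dimensional manifold imbedded in $\overline{M}$ by $i$, with $\xi_{i(p)}\notin i_*(T_pM)$ for each $p\in M$. A $(1,1)$-tensor field $J$ and a $1$-form $\alpha$ on $M$ are determined by $\varphi i_*X=i_*JX+\alpha(X)\xi$;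 one has $J^2=I$. The hypersurface is noninvariant if $\alpha\neq0$ (at every point). The induced affine connection $\nabla$ on $M$ and the symmetric $(0,2)$-tensor $h$ are defined by $\overline{\nabla}_{i_*X}i_*Y=i_*\nabla_XY+h(X,Y)\xi$. Here $M$ is called a locally product manifold if the induced almost product structure is parallel with respect to the induced connection, $\nabla J=0$. *)

(* Defs.v *)
From HB Require Import structures.
From mathcomp Require Import all_boot all_order all_algebra.
From mathcomp Require Import boolp classical_sets functions reals topology.
From mathcomp Require Import normedtype derive.

Set Implicit Arguments.
Unset Strict Implicit.
Unset Printing Implicit Defensive.
Import Order.TTheory GRing.Theory Num.Theory.
Import numFieldNormedType.Exports.
Local Open Scope ring_scope.
Local Open Scope classical_set_scope.

(* f is C^k on the open set U: all iterated directional derivatives of order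
   at most k exist (as Frechet differentials) and are continuous on U. *)
Fixpoint Ck (R : realType) (V W : normedModType R) (k : nat) (f : V -> W)
    (U : set V) : Prop :=
  if k is l.+1 then
    (forall x, U x -> differentiable f x) /\
    (forall v : V, Ck l (fun x => 'd f x v) U)
  else forall x, U x -> {for x, continuous f}.

Definition smooth_at (R : realType) (V W : normedModType R) (f : V -> W)
    (x : V) : Prop :=
  exists U : set V, [/\ open U, U x & forall k, Ck k f U].

(* cinv is total; only its values on the image of the chart matter. *)
Record chart (R : realType) (n : nat) (M : topologicalType) := Chart {
  cdom : set M;
  cmap :> M -> 'rV[R]_n;
  cinv : 'rV[R]_n -> M;
  cdom_open : open cdom;
  cimg_open : open (cmap @` cdom);
  cmapK : forall p, cdom p -> cinv (cmap p) = p;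
  cmap_continuous : forall p, cdom p -> {for p, continuous cmap};
  cinv_continuous : forall p, cdom p -> {for cmap p, continuous cinv} }.

(* A smooth n-manifold.  The atlas is given as a family chart_at p of charts
   around the points p, which also selects the chart whose coordinates
   represent the tangent vectors at p (see tangent). *)
Record manifold (R : realType) (n : nat) := Manifold {
  point :> topologicalType;
  hausdorff_point : hausdorff_space point;
  second_countable_point : @second_countable point;
  chart_at : point -> chart R n point;
  chart_at_dom : forall p, cdom (chart_at p) p;
  chart_compat : forall p q r : point,
    cdom (chart_at p) r -> cdom (chart_at q) r ->
    smooth_at (chart_at q \o cinv (chart_at p)) (chart_at p r) }.

(* T_pM as the space of components with respect to the chart chart_at p.
   The same row vector is in general a different tangent vector at another
   point, so sections are only compared through components (see below). *)
Definition tangent (R : realType) (n : nat) (M : manifold R n) (p : M) :=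
  'rV[R]_n.

Unset Implicit Arguments.

Section Calculus.
Context {R : realType}.

Section Maps.
Context {m n : nat} {M : manifold R m} {N : manifold R n}.

Definition local_rep (f : M -> N) (p : M) : 'rV[R]_m -> 'rV[R]_n :=
  chart_at (f p) \o f \o cinv (chart_at p).

Definition smooth_map (f : M -> N) : Prop :=
  forall p, {for p, continuous f} /\
            smooth_at (local_rep f p) (chart_at p p).

(* f_* *)
Definition tangent_map (f : M -> N) (p : M) (v : tangent p) : tangent (f p) :=
  'd (local_rep f p) (chart_at p p) v.

Definition smooth_embedding (f : M -> N) : Prop :=
  [/\ smooth_map f,
      forall p, injective (tangent_map f p),
      injective f &
      forall (p : M) (A : set M), nbhs p A ->
        exists2 B : set N, nbhs (f p) B & f @^-1` B `<=` A].

End Maps.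

Section OneManifold.
Context {n : nat} {M : manifold R n}.

Definition smooth_fun_at (f : M -> R^o) (p : M) : Prop :=
  smooth_at (f \o cinv (chart_at p)) (chart_at p p).

(* v(f) *)
Definition dir_deriv (f : M -> R^o) (p : M) (v : tangent p) : R^o :=
  'd (f \o cinv (chart_at p)) (chart_at p p) v.

(* Components of v with respect to the chart around p, for q in its domain. *)
Definition comp_at (p q : M) (v : tangent q) : 'rV[R]_n :=
  'd (chart_at p \o cinv (chart_at q)) (chart_at q q) v.

(* The value at q of the j-th coordinate vector field of the chart around p. *)
Definition coord_field (p : M) (j : 'I_n) (q : M) : tangent q :=
  'd (chart_at q \o cinv (chart_at p)) (chart_at p q) (delta_mx 0 j).

Definition smooth_field_at (X : forall q : M, tangent q) (p : M) : Prop :=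
  smooth_at (fun x => comp_at p _ (X (cinv (chart_at p) x))) (chart_at p p).

End OneManifold.

(* Gamma(TM) *)
Record vfield {n : nat} (M : manifold R n) := VField {
  vfield_val :> forall p : M, tangent p;
  vfield_smooth : forall p, smooth_field_at vfield_val p }.

(* A tensor field is smooth when it sends vector fields that are smooth around
   a point to a vector field, or function, that is smooth there. *)
Record tensor11 {n : nat} (M : manifold R n) := Tensor11 {
  tensor11_val :> forall p : M, {linear (tangent p) -> (tangent p)};
  tensor11_smooth : forall p X, smooth_field_at X p ->
    smooth_field_at (fun q => tensor11_val q (X q)) p }.

Record form1 {n : nat} (M : manifold R n) := Form1 {
  form1_val :> forall p : M, {scalar (tangent p)};
  form1_smooth : forall p X, smooth_field_at X p ->
    smooth_fun_at (fun q => form1_val q (X q)) p }.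

Record sym_tensor02 {n : nat} (M : manifold R n) := SymTensor02 {
  tensor02_val :> forall p : M, tangent p -> tangent p -> R;
  tensor02_linear : forall p u, scalar (tensor02_val p u);
  tensor02_sym : forall p (u v : tangent p),
    tensor02_val p u v = tensor02_val p v u;
  tensor02_smooth : forall p X Y,
    smooth_field_at X p -> smooth_field_at Y p ->
    smooth_fun_at (fun q => tensor02_val q (X q) (Y q)) p }.

(* Signature (-,+,...,+), witnessed at each point by an orthonormal basis. *)
Definition lorentzian {n : nat} {M : manifold R n} (g : sym_tensor02 M) :=
  forall p : M, exists2 E : 'M[R]_n, E \in unitmx &
    forall i j, g p (row i E) (row j E) =
      if i != j then 0 else if i == 0%N :> nat then -1 else 1.

(* nabla p v Y is the covariant derivative at p of Y in the direction v.  It is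
   only constrained for fields Y that are smooth around p (Y need not be smooth
   elsewhere), so it depends only on the germ of Y: apply conn_leibniz to the
   indicator function of a neighbourhood of p. *)
Record connection {n : nat} (M : manifold R n) := Connection {
  conn_val :> forall p : M, tangent p -> (forall q : M, tangent q) -> tangent p;
  conn_linear : forall p Y, smooth_field_at Y p ->
    linear (fun v => conn_val p v Y);
  conn_add : forall p v Y Z, smooth_field_at Y p -> smooth_field_at Z p ->
    conn_val p v (fun q => Y q + Z q) = conn_val p v Y + conn_val p v Z;
  conn_leibniz : forall p v (f : M -> R^o) Y,
    smooth_fun_at f p -> smooth_field_at Y p ->
    conn_val p v (fun q => f q *: Y q) =
      dir_deriv f p v *: Y p + f p *: conn_val p v Y;
  conn_smooth : forall p X Y, smooth_field_at X p -> smooth_field_at Y p ->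
    smooth_field_at (fun q => conn_val q (X q) Y) p }.

(* nabla_X Y - nabla_Y X = [X, Y], tested on functions. *)
Definition torsion_free {n : nat} {M : manifold R n} (nabla : connection M) :=
  forall p X Y (f : M -> R^o),
    smooth_field_at X p -> smooth_field_at Y p -> smooth_fun_at f p ->
    dir_deriv f p (nabla p (X p) Y - nabla p (Y p) X) =
      dir_deriv (fun q => dir_deriv f q (Y q)) p (X p)
      - dir_deriv (fun q => dir_deriv f q (X q)) p (Y p).

Definition metric_compatible {n : nat} {M : manifold R n} (g : sym_tensor02 M)
    (nabla : connection M) :=
  forall p (v : tangent p) X Y, smooth_field_at X p -> smooth_field_at Y p ->
    dir_deriv (fun q => g q (X q) (Y q)) p v =
      g p (nabla p v X) (Y p) + g p (X p) (nabla p v Y).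

Definition levi_civita {n : nat} {M : manifold R n} (g : sym_tensor02 M)
    (nabla : connection M) :=
  torsion_free nabla /\ metric_compatible g nabla.

(* (nabla_v J) Y; tensorial in Y, hence meaningful for Y smooth around p. *)
Definition cov_deriv11 {n : nat} {M : manifold R n} (nabla : connection M)
    (J : tensor11 M) (p : M) (v : tangent p) (Y : forall q : M, tangent q) :=
  nabla p v (fun q => J q (Y q)) - J p (nabla p v Y).

Definition ac_structure {n : nat} {M : manifold R n} (phi : tensor11 M)
    (xi : vfield M) (eta : form1 M) :=
  [/\ forall p, xi p != 0,
      forall p, phi p (xi p) = 0 &
      forall p v, phi p (phi p v) = v + eta p v *: xi p].

Definition lorentzian_almost_paracontact {n : nat} {M : manifold R n}
    (phi : tensor11 M) (xi : vfield M) (eta : form1 M) (g : sym_tensor02 M) :=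
  [/\ ac_structure phi xi eta,
      lorentzian g,
      forall p u, g p u (xi p) = eta p u &
      forall p u v, g p (phi p u) (phi p v) = g p u v + eta p u * eta p v].

Definition lorentzian_para_sasakian {n : nat} {M : manifold R n}
    (phi : tensor11 M) (xi : vfield M) (eta : form1 M) (g : sym_tensor02 M)
    (nabla : connection M) :=
  [/\ lorentzian_almost_paracontact phi xi eta g,
      levi_civita g nabla &
      forall p (v : tangent p) Y, smooth_field_at Y p ->
        cov_deriv11 nabla phi p v Y =
          eta p (Y p) *: v + g p v (Y p) *: xi p
          + (2 * eta p v * eta p (Y p)) *: xi p].

Definition parallel11 {n : nat} {M : manifold R n} (nabla : connection M)
    (J : tensor11 M) :=
  forall (X Y : vfield M) (p : M), cov_deriv11 nabla J p (X p) Y = 0.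

Section Hypersurface.
Context {n : nat} {Mbar : manifold R n.+1} {M : manifold R n}.

(* nabla_(i_* v) V for a vector field V along i: writing V = V^j E_j near p,
   with E_j the coordinate fields around i p, this is
   v(V^j) E_j + V^j nabla_(i_* v) E_j, i.e. nabla_(i_* v) Z for every local
   extension Z of V. *)
Definition cov_along (nabla : connection Mbar) (i : M -> Mbar) (p : M)
    (v : tangent p) (V : forall q : M, tangent (i q)) : tangent (i p) :=
  \sum_j (dir_deriv (fun q => comp_at (i p) (i q) (V q) 0 j) p v
            *: coord_field (i p) j (i p)
          + comp_at (i p) (i p) (V p) 0 j
            *: nabla (i p) (tangent_map i p v) (coord_field (i p) j)).

Definition nowhere_tangent (i : M -> Mbar) (xi : vfield Mbar) :=
  forall (p : M) (v : tangent p), tangent_map i p v <> xi (i p).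

Definition induced_structure (i : M -> Mbar) (phi : tensor11 Mbar)
    (xi : vfield Mbar) (J : tensor11 M) (alpha : form1 M) :=
  forall (p : M) (v : tangent p),
    phi (i p) (tangent_map i p v) =
      tangent_map i p (J p v) + alpha p v *: xi (i p).

Definition noninvariant (alpha : form1 M) :=
  forall p : M, exists v : tangent p, alpha p v != 0.

Definition induced_connection (nablabar : connection Mbar) (i : M -> Mbar)
    (xi : vfield Mbar) (nabla : connection M) (h : sym_tensor02 M) :=
  forall (p : M) (v : tangent p) Y, smooth_field_at Y p ->
    cov_along nablabar i p v (fun q => tangent_map i q (Y q)) =
      tangent_map i p (nabla p v Y) + h p v (Y p) *: xi (i p).

End Hypersurface.
End Calculus.

(* Main.v *)
From HB Require Import structures.
Require Import Defs.
From mathcomp Require Import all_boot all_order all_algebra.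
From mathcomp Require Import boolp classical_sets functions reals topology.
From mathcomp Require Import landau normedtype derive.
Import Order.TTheory GRing.Theory Num.Theory.
Import numFieldNormedType.Exports.
Local Open Scope ring_scope.
Local Open Scope classical_set_scope.
Set Implicit Arguments.
Unset Strict Implicit.

(** The theorem follows from an explicit formula for the covariant derivative
    of the induced almost product structure,

      (nabla_X J) Y = alpha (J Y) X - alpha (Y) J X,

    proved as [cov_deriv_induced]; both directions are then immediate.

    The formula is the tangential part of one equation along the immersion.
    Differentiate phi (i_* Y) = i_* (J Y) + alpha (Y) xi in the direction
    i_* X.  On the left, the product rule gives the derivative of phi, which
    the para-Sasakian identity makes equal to eta (i_* Y) i_* X modulo xi, plus
    phi applied to nabla_X (i_* Y) = i_* (nabla_X Y) + h (X, Y) xi, which is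
    i_* (J (nabla_X Y)) modulo xi.  On the right one gets
    i_* (nabla_X (J Y)) + alpha (Y) nabla_X xi modulo xi.  The para-Sasakian
    identity applied to xi gives nabla xi = phi ([conn_xi]), so nabla_X xi is
    i_* (J X) modulo xi; and phi^2 = I + eta (x) xi gives
    eta (i_* Y) = alpha (J Y) ([alpha_J]).  Since xi is transverse and i_* is
    injective, tangential parts can be compared ([tangent_xi_decomp]).

    Most of the work is to justify the calculus of vector fields along a map
    in terms of charts.  A vector field along i is in general not the
    restriction of one on the ambient manifold, and its derivative is given by
    a formula in the coordinate frame E_j around i p.  That formula is a
    derivation ([cov_alongD], [cov_alongZ]) and agrees with the ambient
    connection on restrictions Z o i ([cov_along_restrict]); the latter needs
    the connection to be local ([conn_near_eq]), its expansion in the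
    frame ([conn_coord]), and the chain rule for i_* ([dir_deriv_comp]).
    The product rule for phi ([cov_along_tensor11]) follows by writing
    phi V = V^j phi (E_j) near p. *)

(** * Germs of differentiable and smooth maps *)
Lemma near_eq_diff_locally {K : numFieldType} {V W : normedModType K}
    (f g : V -> W) (df : V -> W) (x : V) : {near x, f =1 g} ->
  (forall y, f y = f (lim (nbhs x)) + df (y - lim (nbhs x))
                   +o_(y \near x) (y - lim (nbhs x))) ->
  (forall y, g y = g (lim (nbhs x)) + df (y - lim (nbhs x))
                   +o_(y \near x) (y - lim (nbhs x))).
Proof.
move=> fg /funext fE.
have fgx : f (lim (nbhs x)) = g (lim (nbhs x)).
  by rewrite lim_id//; exact: (nbhs_singleton fg).
move/eqaddoP in fE.
have /funeqP// : g = (fun y => g (lim (nbhs x)) + df (y - lim (nbhs x)))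
                   +o_x (fun y => y - lim (nbhs x)).
apply/eqaddoP => e e0; have := fE e e0.
apply: filterS2 fg => y /= fgy.
by rewrite /= !fctE fgx fgy.
Qed.

(** The differential is a choice among the linear maps that satisfy a condition
    on the germ of the map, so maps with the same germ have the same
    differential even where they are not differentiable. *)
Lemma near_eq_diff {K : numFieldType} {V W : normedModType K}
    (f g : V -> W) (x : V) : {near x, f =1 g} -> 'd f x = 'd g x.
Proof.
move=> fg; rewrite /diff; congr (get _); apply/funext => df; apply/propext.
split=> -[dfc fE]; split=> //; first exact: near_eq_diff_locally fE.
apply: near_eq_diff_locally fE; by apply: filterS fg => y ->.
Qed.

Lemma near_eq_differentiable {K : numFieldType} {V W : normedModType K}
    (f g : V -> W) (x : V) : {near x, f =1 g} ->
  differentiable f x -> differentiable g x.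
Proof.
move=> fg /diffP[dfc fE]; apply/diffP; rewrite -(near_eq_diff fg).
by split=> //; exact: near_eq_diff_locally fE.
Qed.

Lemma linear_rV_continuous {R : realType} {n : nat} {W : normedModType R}
  (L : {linear 'rV[R]_n -> W}) : continuous L.
Proof.
have -> : (L : _ -> _) = \sum_(j < n) (fun u : 'rV[R]_n => u 0 j *: L 'e_j).
  apply/funext => u; rewrite fct_sumE {1}(row_sum_delta u) linear_sum.
  by apply: eq_bigr => j _; rewrite linearZ.
elim/big_ind: _ => [|f g cf cg|j _] u; first exact: cst_continuous.
  by apply: continuousD; [exact: cf|exact: cg].
exact: continuous_comp (@coord_continuous _ _ _ _ _ _) (@scalel_continuous _ _ _ _).
Qed.

Section Ck_theory.
Context {R : realType} {V W : normedModType R}.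
Implicit Types (f g : V -> W) (U : set V) (x : V).

Lemma open_eq_near f g U x : open U -> {in U, f =1 g} -> U x -> {near x, f =1 g}.
Proof.
move=> oU fg Ux; apply: (filterS _ (open_nbhs_nbhs (conj oU Ux))) => y Uy.
by apply: fg; rewrite inE.
Qed.

(** Openness of U matters: the differentials at a point of U are determined by
    the values on U only when U is a neighbourhood of that point. *)
Lemma Ck_eq k f g U : open U -> {in U, f =1 g} -> Ck k f U -> Ck k g U.
Proof.
move=> oU; elim: k f g => [|k IH] f g fg /=.
  move=> cf x Ux; have fgx := open_eq_near oU fg Ux.
  have fgx_at : f x = g x := nbhs_singleton fgx.
  rewrite /= /prop_for /continuous_at -fgx_at.
  by apply: cvg_trans (cf x Ux); apply: near_eq_cvg; apply: filterS fgx => y ->.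
move=> [df Cdf]; split=> [x Ux|v].
  exact: near_eq_differentiable (open_eq_near oU fg Ux) (df x Ux).
apply: IH (Cdf v) => x; rewrite inE => Ux.
by rewrite (near_eq_diff (open_eq_near oU fg Ux)).
Qed.

Lemma Ck_subset k f U U' : U' `<=` U -> Ck k f U -> Ck k f U'.
Proof.
move=> UU'; elim: k f => [|k IH] f /= => [cf x /UU'|[df Cdf]]; first exact: cf.
by split=> [x /UU'/df//|v]; exact: IH (Cdf v).
Qed.

Lemma Ck_cst k (w : W) U : Ck k (fun=> w) U.
Proof.
elim: k w => [|k IH] w /=; first by move=> x _; exact: cst_continuous.
split=> [x _|v]; first exact: differentiable_cst.
by under eq_fun do rewrite diff_cst; exact: IH.
Qed.

End Ck_theory.

Lemma Ck_linear {R : realType} {m : nat} {V W : normedModType R} k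
    (L : {linear 'rV[R]_m -> W}) (f : V -> 'rV[R]_m) (U : set V) :
  open U -> Ck k f U -> Ck k (L \o f) U.
Proof.
have cL := @linear_rV_continuous _ _ _ L.
move=> oU; elim: k f => [|k IH] f /=.
  by move=> cf x Ux; apply: continuous_comp (cf x Ux) (cL _).
have dL x := linear_differentiable x cL.
move=> [df Cdf]; split=> [x Ux|v]; first exact: differentiable_comp (df x Ux) (dL _).
apply: Ck_eq oU _ (IH _ (Cdf v)) => x; rewrite inE => Ux /=.
by rewrite (diff_comp (df x Ux) (dL _)) /= (diff_lin _ cL).
Qed.

Section smooth_at_theory.
Context {R : realType} {V W : normedModType R}.
Implicit Types (f g : V -> W) (x : V).

Lemma smooth_at_near_eq f g x : {near x, f =1 g} -> smooth_at f x -> smooth_at g x.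
Proof.
rewrite {1}/prop_near1 nbhsE => -[A [oA Ax] fg] [U [oU Ux CU]].
have oUA : open (U `&` A) by exact: openI.
exists (U `&` A); split=> // k; apply: (@Ck_eq _ _ _ k f) => // [y|].
  by rewrite inE => -[_ /fg].
by apply: Ck_subset (CU k) => y [].
Qed.

Lemma smooth_at_cst (w : W) x : smooth_at (fun=> w) x.
Proof. by exists setT; split; [exact: openT| |move=> k; exact: Ck_cst]. Qed.

Lemma smooth_at_near_differentiable f x : smooth_at f x ->
  \forall y \near x, differentiable f y.
Proof.
move=> [U [oU Ux CU]]; apply: filterS (open_nbhs_nbhs (conj oU Ux)) => y.
exact: (CU 1%N).1.
Qed.

Lemma smooth_at_differentiable f x : smooth_at f x -> differentiable f x.
Proof. by move=> /smooth_at_near_differentiable/nbhs_singleton. Qed.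

Lemma smooth_at_diff f x v : smooth_at f x -> smooth_at (fun y => 'd f y v) x.
Proof.
move=> [U [oU Ux CU]]; exists U; split=> // k; exact: (CU k.+1).2.
Qed.

(** This replaces general sum and product rules for smooth maps: the partial
    sums of a field in a coordinate frame, and its single components, are all
    linear images of its component vector. *)
Lemma smooth_at_linear {m : nat} (L : {linear 'rV[R]_m -> W})
  (f : V -> 'rV[R]_m) x : smooth_at f x -> smooth_at (L \o f) x.
Proof.
by move=> [U [oU Ux CU]]; exists U; split=> // k; exact: Ck_linear (CU k).
Qed.

End smooth_at_theory.

(** * Charts, components and coordinate fields *)

Section chart_theory.
Context {R : realType} {n : nat} {T : topologicalType} (c : chart R n T).

Lemma cinvK x : (c @` cdom c) x -> c (cinv c x) = x /\ cdom c (cinv c x).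
Proof. by move=> [p cp <-]; rewrite cmapK. Qed.

Lemma near_cdom p : cdom c p -> \forall q \near p, cdom c q.
Proof. by move=> cp; exact: open_nbhs_nbhs (conj (cdom_open c) cp). Qed.

Lemma near_cinvK p : cdom c p ->
  \forall x \near c p, c (cinv c x) = x /\ cdom c (cinv c x).
Proof.
move=> cp; have : open_nbhs (c p) (c @` cdom c).
  by split; [exact: cimg_open|exists p].
by move/open_nbhs_nbhs; apply: filterS => x; exact: cinvK.
Qed.

(** With [near_cmap], the passage between statements that hold near a point of
    the manifold and statements that hold near its coordinates. *)
Lemma near_cinv p (P : set T) : cdom c p ->
  (\forall q \near p, P q) -> \forall x \near c p, P (cinv c x).
Proof.
by move=> cp Pp; apply: (cinv_continuous cp); rewrite /= cmapK.
Qed.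

Lemma near_cmap p (P : set 'rV[R]_n) : cdom c p ->
  (\forall x \near c p, P x) -> \forall q \near p, P (c q).
Proof. by move=> cp Pp; exact: (cmap_continuous cp). Qed.

End chart_theory.

Section manifold_theory.
Context {R : realType} {n : nat} {M : manifold R n}.
Implicit Types (p q r : M).

(** The transition maps in the two directions are mutually inverse near r, so
    the chain rule makes their differentials inverse to each other. *)
Lemma transition_diffK p q r (v : 'rV[R]_n) :
  cdom (chart_at p) r -> cdom (chart_at q) r ->
  'd (chart_at q \o cinv (chart_at p)) (chart_at p r)
    ('d (chart_at p \o cinv (chart_at q)) (chart_at q r) v) = v.
Proof.
move=> pr qr; set f := _ \o cinv (chart_at p); set g := _ \o cinv (chart_at q).
have gr : g (chart_at q r) = chart_at p r by rewrite /g /= cmapK.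
have df : differentiable f (g (chart_at q r)).
  by rewrite gr; exact: smooth_at_differentiable (chart_compat pr qr).
have dg := smooth_at_differentiable (chart_compat qr pr).
rewrite -gr -[LHS]/(('d f (g (chart_at q r)) \o 'd g (chart_at q r)) v).
rewrite -diff_comp //.
have /near_eq_diff -> : {near chart_at q r, f \o g =1 (idfun : 'rV_n -> 'rV_n)}.
  have := near_cinv qr (near_cdom pr); apply: filterS2 (near_cinvK qr).
  by move=> x [xK _] px; rewrite /f /g /= cmapK.
by rewrite diff_lin // => x; exact: cvg_id.
Qed.

Lemma comp_atD p q (v w : tangent q) :
  comp_at p q (v + w) = comp_at p q v + comp_at p q w.
Proof. exact: linearD. Qed.

Lemma comp_atZ p q a (v : tangent q) : comp_at p q (a *: v) = a *: comp_at p q v.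
Proof. exact: linearZ. Qed.

(** The coordinate fields of the chart around p are a frame on the whole domain
    of that chart, and [comp_at] gives the coefficients in it. *)
Lemma sum_comp_coord p q (v : tangent q) : cdom (chart_at p) q ->
  \sum_j comp_at p q v 0 j *: coord_field p j q = v.
Proof.
move=> pq; transitivity ('d (chart_at q \o cinv (chart_at p)) (chart_at p q)
    (\sum_j comp_at p q v 0 j *: 'e_j)).
  by rewrite linear_sum; apply: eq_bigr => j _; rewrite linearZ.
by rewrite -row_sum_delta; exact: transition_diffK pq (chart_at_dom q).
Qed.

Lemma comp_coord_field p q j : cdom (chart_at p) q ->
  comp_at p q (coord_field p j q) = 'e_j.
Proof. by move=> pq; exact: transition_diffK (chart_at_dom q) pq. Qed.

Lemma smooth_field_near_eq p (X Y : forall q, tangent q) :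
  (\forall q \near p, X q = Y q) -> smooth_field_at X p -> smooth_field_at Y p.
Proof.
move=> XY; apply: smooth_at_near_eq.
by apply: filterS (near_cinv (chart_at_dom p) XY) => x ->.
Qed.

Lemma smooth_fun_near_eq p (f g : M -> R^o) :
  {near p, f =1 g} -> smooth_fun_at f p -> smooth_fun_at g p.
Proof.
move=> fg; apply: smooth_at_near_eq; exact: (near_cinv (chart_at_dom p) fg).
Qed.

Lemma smooth_fun_cst p (a : R^o) : smooth_fun_at (fun=> a) p.
Proof. exact: smooth_at_cst. Qed.

Lemma dir_deriv_near_eq p (f g : M -> R^o) (v : tangent p) :
  {near p, f =1 g} -> dir_deriv f p v = dir_deriv g p v.
Proof.
move=> fg; rewrite /dir_deriv; congr (_ v : R); congr (GRing.Linear.sort _).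
exact/near_eq_diff/(near_cinv (chart_at_dom p) fg).
Qed.

Lemma dir_deriv_cst p (a : R^o) (v : tangent p) : dir_deriv (fun=> a) p v = 0.
Proof. by rewrite /dir_deriv -[_ \o _]/(fun=> a) diff_cst. Qed.

(** For the induction that expands a connection in a frame, every partial
    sum must itself be an admissible argument of the connection.  The components
    of a partial sum form a linear image of the components of X. *)
Lemma smooth_partial_frame_sum p (X : forall q : M, tangent q) (r : seq 'I_n) :
  smooth_field_at X p ->
  smooth_field_at (fun q => \sum_(j <- r) comp_at p q (X q) 0 j *: coord_field p j q) p.
Proof.
pose f (u : 'rV[R]_n) : 'rV[R]_n := \sum_(j <- r) u 0 j *: 'e_j.
have fl : linear f.
  move=> a u v; rewrite /f scaler_sumr -big_split; apply: eq_bigr => j _ /=.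
  by rewrite !mxE scalerDl scalerA.
pose fM := GRing.isLinear.Build _ _ _ _ _ fl.
pose L : {linear _ -> _} := HB.pack f fM.
move=> sX; apply: smooth_at_near_eq (smooth_at_linear L sX).
apply: filterS (near_cinvK (chart_at_dom p)) => x [xK px].
rewrite [RHS]linear_sum /= /f; apply: eq_bigr => j _.
by rewrite linearZ; congr (_ *: _); exact/esym/(comp_coord_field _ px).
Qed.

Lemma smooth_coord_field p j : smooth_field_at (coord_field p j) p.
Proof.
apply: smooth_at_near_eq (smooth_at_cst 'e_j _).
by apply: filterS (near_cinvK (chart_at_dom p)) => x [_ px]; rewrite comp_coord_field.
Qed.

Lemma smooth_comp p (X : forall q : M, tangent q) j : smooth_field_at X p ->
  smooth_fun_at (fun q => comp_at p q (X q) 0 j : R^o) p.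
Proof.
pose f (u : 'rV[R]_n) : R^o := u 0 j.
have fl : linear f by move=> a u v; rewrite /f !mxE.
pose fM := GRing.isLinear.Build _ _ _ _ _ fl.
pose L : {linear _ -> _} := HB.pack f fM.
exact: (smooth_at_linear L).
Qed.

End manifold_theory.

(** * Locality of a connection and its expansion in a frame *)

Section connection_theory.
Context {R : realType} {n : nat} {M : manifold R n} (nabla : connection M).
Implicit Types (p q : M) (X Y Z : forall q : M, tangent q).

(** Let f be the indicator function of the set where Y and Z agree.  Then
    f Y = f Z everywhere, and since f is 1 near p, the Leibniz rule shows that
    multiplication by f does not change the derivative at p. *)
Lemma conn_near_eq p (v : tangent p) Y Z : (\forall q \near p, Y q = Z q) ->
  smooth_field_at Y p -> nabla p v Y = nabla p v Z.
Proof.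
move=> YZ sY; have sZ := smooth_field_near_eq YZ sY.
pose f q : R^o := if `[< Y q = Z q >] then 1 else 0.
have f1 : {near p, f =1 (fun=> 1)}.
  by apply: filterS YZ => q YZq; rewrite /f asboolT.
have sf : smooth_fun_at f p.
  apply: smooth_fun_near_eq (smooth_fun_cst p 1); by apply: filterS f1 => q ->.
have fp : f p = 1 := nbhs_singleton f1.
have fX X : smooth_field_at X p -> nabla p v X = nabla p v (fun q => f q *: X q).
  move=> sX; rewrite conn_leibniz // (dir_deriv_near_eq _ f1) dir_deriv_cst.
  by rewrite fp scale0r scale1r add0r.
rewrite (fX Y sY) (fX Z sZ); congr conn_val; apply: functional_extensionality_dep => q.
by rewrite /f; case: asboolP => [->//|_]; rewrite !scale0r.
Qed.

Lemma smooth_field0 p : smooth_field_at (fun q => 0 : tangent q) p.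
Proof.
apply: smooth_at_near_eq (smooth_at_cst 0 _).
by apply: (filterE (F := nbhs (chart_at p p))) => x; rewrite /comp_at linear0.
Qed.

Lemma conn0 p (v : tangent p) : nabla p v (fun q => 0) = 0.
Proof.
have := conn_add _ nabla _ v _ _ (smooth_field0 p) (smooth_field0 p).
rewrite (_ : (fun _ => _ + _) = (fun q : M => 0 : tangent q)); last first.
  by apply: functional_extensionality_dep => q; rewrite addr0.
by move/eqP; rewrite -subr_eq subrr => /eqP.
Qed.

(** The right-hand side is the formula that defines [cov_along], with the
    identity in place of the immersion; hence this is what identifies
    [cov_along] with the ambient connection on restrictions. *)
Lemma conn_coord p (v : tangent p) Z : smooth_field_at Z p ->
  nabla p v Z =
  \sum_j (dir_deriv (fun q => comp_at p q (Z q) 0 j) p v *: coord_field p j p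
     + comp_at p p (Z p) 0 j *: nabla p v (coord_field p j)).
Proof.
move=> sZ.
pose S r q : tangent q := \sum_(j <- r) comp_at p q (Z q) 0 j *: coord_field p j q.
have -> : nabla p v Z = nabla p v (S (index_enum 'I_n)).
  apply: conn_near_eq sZ; apply: filterS (near_cdom (chart_at_dom p)) => q pq.
  by rewrite /S sum_comp_coord.
elim: (index_enum _) => [|j r IH].
  by rewrite big_nil -[RHS](conn0 v); congr conn_val;
     apply: functional_extensionality_dep => q; rewrite /S big_nil.
rewrite big_cons -IH -conn_leibniz; [|exact: smooth_comp|exact: smooth_coord_field].
rewrite -conn_add.
- by congr conn_val; apply: functional_extensionality_dep => q; rewrite /S big_cons.
- have := @smooth_partial_frame_sum _ _ _ p Z [:: j] sZ.
  by apply: smooth_field_near_eq; apply: (filterE (F := nbhs p)) => q; rewrite big_seq1.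
- exact: smooth_partial_frame_sum.
Qed.

End connection_theory.

(** * Derivatives of functions and the chain rule for the tangent map *)

Section differentiable_functions.
Context {R : realType} {n : nat} {M : manifold R n}.
Implicit Types (f g : M -> R^o) (p : M).

(** First-order differentiability suffices for the rules satisfied by
    derivatives along a map, and products are easier to control for it than for
    smoothness. *)
Definition diff_fun_at f p := differentiable (f \o cinv (chart_at p)) (chart_at p p).

Lemma smooth_fun_diff f p : smooth_fun_at f p -> diff_fun_at f p.
Proof. exact: smooth_at_differentiable. Qed.

Lemma diff_funD f g p : diff_fun_at f p -> diff_fun_at g p ->
  diff_fun_at (fun q => f q + g q) p.
Proof. exact: differentiableD. Qed.

Lemma diff_funM f g p : diff_fun_at f p -> diff_fun_at g p ->
  diff_fun_at (fun q => f q * g q) p.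
Proof. exact: differentiableM. Qed.

Lemma dir_derivD f g p (v : tangent p) : diff_fun_at f p -> diff_fun_at g p ->
  dir_deriv (fun q => f q + g q) p v = dir_deriv f p v + dir_deriv g p v.
Proof.
by move=> df dg; exact: (congr1 (@^~ v) (diffD df dg)).
Qed.

Lemma dir_derivM f g p (v : tangent p) : diff_fun_at f p -> diff_fun_at g p ->
  dir_deriv (fun q => f q * g q) p v = dir_deriv f p v * g p + f p * dir_deriv g p v.
Proof.
move=> df dg; apply: etrans (congr1 (@^~ v) (diffM df dg)) _ => /=.
have -> : cinv (chart_at p) (chart_at p p) = p by exact/cmapK/chart_at_dom.
by apply: etrans (addrC _ _) _; congr (_ + _); exact: mulrC.
Qed.

End differentiable_functions.

Section smooth_maps.
Context {R : realType} {m n : nat} {M : manifold R m} {N : manifold R n}.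
Variable (i : M -> N).
Hypothesis si : smooth_map i.
Implicit Types (p q : M).

Lemma near_map p (P : set N) : (\forall y \near i p, P y) -> \forall q \near p, P (i q).
Proof. exact: (si p).1. Qed.

Lemma local_rep_center p : local_rep i p (chart_at p p) = chart_at (i p) (i p).
Proof. by rewrite /local_rep /= (cmapK (chart_at_dom _)). Qed.

Lemma tangent_mapD p (v w : tangent p) :
  tangent_map i p (v + w) = tangent_map i p v + tangent_map i p w.
Proof. exact: linearD. Qed.

Lemma tangent_mapZ p (a : R) (v : tangent p) :
  tangent_map i p (a *: v) = a *: tangent_map i p v.
Proof. exact: linearZ. Qed.

(** The chain rule for f o i, with i read in the charts around p and i p. *)
Lemma dir_deriv_comp p (v : tangent p) (f : N -> R^o) : diff_fun_at f (i p) ->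
  diff_fun_at (f \o i) p /\
  dir_deriv (f \o i) p v = dir_deriv f (i p) (tangent_map i p v).
Proof.
rewrite /diff_fun_at /dir_deriv /tangent_map -local_rep_center => df.
have dr := smooth_at_differentiable (si p).2.
have fi : {near chart_at p p,
    (f \o cinv (chart_at (i p))) \o local_rep i p =1 (f \o i) \o cinv (chart_at p)}.
  have := near_cinv (chart_at_dom p) (near_map (near_cdom (chart_at_dom (i p)))).
  by apply: filterS => x ix; rewrite /local_rep /= cmapK.
split; first exact: near_eq_differentiable fi (differentiable_comp dr df).
by rewrite -(near_eq_diff fi) (diff_comp dr df).
Qed.

(** The definition of i_* at q uses the charts around q and i q, which vary
    with q.  Read in the fixed charts around p and i p, it becomes the
    differential of the fixed map [local_rep i p], which exhibits how i_*
    depends on q. *)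
Lemma comp_tangent_map p : \forall q \near p, forall v : tangent q,
  comp_at (i p) (i q) (tangent_map i q v) =
  'd (local_rep i p) (chart_at p q) (comp_at p q v).
Proof.
have near_dr := near_cmap (chart_at_dom p) (smooth_at_near_differentiable (si p).2).
have near_ip := near_map (near_cdom (chart_at_dom (i p))).
near=> q => v.
have pq : cdom (chart_at p) q by near: q; exact: near_cdom (chart_at_dom p).
have ipq : cdom (chart_at (i p)) (i q) by near: q.
have dr : differentiable (local_rep i p) (chart_at p q) by near: q.
have diq := smooth_at_differentiable (si q).2.
have dN := smooth_at_differentiable (chart_compat (chart_at_dom (i q)) ipq).
have dM := smooth_at_differentiable (chart_compat (chart_at_dom q) pq).
rewrite -local_rep_center in dN.
set f := chart_at (i p) \o cinv (chart_at (i q)) in dN *.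
set g := chart_at p \o cinv (chart_at q) in dM *.
have gq : g (chart_at q q) = chart_at p q by rewrite /g /= (cmapK (chart_at_dom _)).
rewrite -gq in dr *.
transitivity ('d (f \o local_rep i q) (chart_at q q) v).
  by rewrite (diff_comp diq dN) /= local_rep_center.
transitivity ('d (local_rep i p \o g) (chart_at q q) v); last first.
  exact: (congr1 (@^~ v) (diff_comp dM dr)).
suff fg : {near chart_at q q, f \o local_rep i q =1 local_rep i p \o g}.
  exact: (congr1 (fun L : {linear _ -> _} => L v) (near_eq_diff fg)).
have near_p := near_cinv (chart_at_dom q) (near_cdom pq).
have := near_cinv (chart_at_dom q) (near_map (near_cdom (chart_at_dom (i q)))).
apply: filterS2 near_p => x px ix.
by rewrite /f /g /local_rep /= !cmapK.
Unshelve. all: by end_near. Qed.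

(** In the charts around p and i p the components of i_* Y are
    x |-> sum_k y_k (x) d_k F_j (x), where F represents i and y represents Y. *)
Lemma diff_comp_tangent_map p (Y : forall q : M, tangent q) j :
  smooth_field_at Y p ->
  diff_fun_at (fun q => comp_at (i p) (i q) (tangent_map i q (Y q)) 0 j) p.
Proof.
move=> sY; set F := local_rep i p.
pose G (x : 'rV[R]_m) : R^o :=
  \sum_k (comp_at p _ (Y (cinv (chart_at p) x)) 0 k * 'd F x 'e_k 0 j).
apply: (@near_eq_differentiable _ _ _ G).
  have := near_cinv (chart_at_dom p) (comp_tangent_map p).
  apply: filterS2 (near_cinvK (chart_at_dom p)) => x [xK px] /= ->.
  rewrite xK [in RHS](row_sum_delta (comp_at _ _ _)) linear_sum summxE.
  by apply: eq_bigr => k _; rewrite linearZ mxE.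
rewrite /G (_ : (fun x => _) = \sum_k (fun x =>
   comp_at p _ (Y (cinv (chart_at p) x)) 0 k * 'd F x 'e_k 0 j)); last first.
  by apply/funext => x; rewrite fct_sumE.
apply: differentiable_sum => k; apply: differentiableM.
  exact: smooth_at_differentiable (smooth_comp k sY).
apply: (@differentiable_comp _ _ _ _ (fun x => 'd F x 'e_k)
  (fun u : 'rV[R]_n => u 0 j : R)).
  exact: smooth_at_differentiable (smooth_at_diff _ (si p).2).
exact: differentiable_coord.
Qed.

End smooth_maps.

(** * Covariant derivatives of vector fields along a map *)

Section fields_along.
Context {R : realType} {n : nat} {N : manifold R n.+1} {M : manifold R n}.
Variables (nabla : connection N) (i : M -> N).
Hypothesis si : smooth_map i.
Implicit Types (p q : M) (V W : forall q : M, tangent (i q)).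

Definition comp_along p V j : M -> R^o :=
  fun q => comp_at (i p) (i q) (V q) 0 j.

Definition diff_along V p := forall j, diff_fun_at (comp_along p V j) p.

Lemma near_cdom_map p : \forall q \near p, cdom (chart_at (i p)) (i q).
Proof. exact: (near_map si) (near_cdom (chart_at_dom _)). Qed.

Lemma cov_along_near_eq p (v : tangent p) V W :
  (\forall q \near p, V q = W q) -> cov_along nabla i p v V = cov_along nabla i p v W.
Proof.
move=> VW; have VWp : V p = W p := nbhs_singleton VW.
apply: eq_bigr => j _; rewrite VWp.
rewrite (@dir_deriv_near_eq _ _ _ p _ (comp_along p W j)) //.
by apply: filterS VW => q VWq; rewrite /comp_along VWq.
Qed.

Lemma diff_alongD p V W : diff_along V p -> diff_along W p ->
  diff_along (fun q => V q + W q) p.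
Proof.
move=> dV dW j; rewrite /comp_along.
under eq_fun do rewrite comp_atD mxE.
exact: diff_funD (dV j) (dW j).
Qed.

Lemma cov_alongD p (v : tangent p) V W : diff_along V p -> diff_along W p ->
  cov_along nabla i p v (fun q => V q + W q) =
  cov_along nabla i p v V + cov_along nabla i p v W.
Proof.
move=> dV dW; rewrite /cov_along -big_split; apply: eq_bigr => j _ /=.
under eq_fun do rewrite comp_atD mxE.
rewrite (dir_derivD v (dV j) (dW j)) comp_atD mxE !scalerDl.
exact: addrACA.
Qed.

Lemma diff_alongZ p (f : M -> R^o) V : diff_fun_at f p -> diff_along V p ->
  diff_along (fun q => f q *: V q) p.
Proof.
move=> df dV j; rewrite /comp_along.
under eq_fun do rewrite comp_atZ mxE.
exact: diff_funM df (dV j).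
Qed.

(** The terms in which f is differentiated add up to the expansion of V p in
    the coordinate frame. *)
Lemma cov_alongZ p (v : tangent p) (f : M -> R^o) V :
  diff_fun_at f p -> diff_along V p ->
  cov_along nabla i p v (fun q => f q *: V q) =
  dir_deriv f p v *: V p + f p *: cov_along nabla i p v V.
Proof.
move=> df dV; rewrite -[V p in RHS](sum_comp_coord _ (chart_at_dom (i p))).
rewrite /cov_along !scaler_sumr -big_split; apply: eq_bigr => j _ /=.
under eq_fun do rewrite comp_atZ mxE.
rewrite (dir_derivM v df (dV j)) comp_atZ mxE scalerDl scalerDr !scalerA -addrA.
by [].
Qed.

Lemma cov_along_sum (I : Type) (r : seq I) p (v : tangent p)
    (V : I -> forall q, tangent (i q)) : (forall k, diff_along (V k) p) ->
  diff_along (fun q => \sum_(k <- r) V k q) p /\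
  cov_along nabla i p v (fun q => \sum_(k <- r) V k q) =
  \sum_(k <- r) cov_along nabla i p v (V k).
Proof.
move=> dV; elim: r => [|k r [dS cS]].
  have -> : (fun q => \sum_(k <- [::]) V k q) = (fun q => 0).
    by apply: functional_extensionality_dep => q; rewrite big_nil.
  have comp0 j : comp_along p (fun q => 0) j = fun=> 0.
    by apply/funext => q; rewrite /comp_along /comp_at linear0 mxE.
  split=> [j|]; first by rewrite comp0; exact/smooth_fun_diff/smooth_fun_cst.
  rewrite big_nil /cov_along big1 // => j _.
  rewrite -[X in dir_deriv X]/(comp_along p (fun q => 0) j) comp0 dir_deriv_cst.
  by rewrite /comp_at linear0 mxE !scale0r addr0.
have -> : (fun q => \sum_(l <- k :: r) V l q) =
          (fun q => V k q + \sum_(l <- r) V l q).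
  by apply: functional_extensionality_dep => q; rewrite big_cons.
by rewrite big_cons -cS; split; [exact: diff_alongD|exact: cov_alongD].
Qed.

Lemma diff_along_restrict p (Z : forall y : N, tangent y) :
  smooth_field_at Z (i p) -> diff_along (fun q => Z (i q)) p.
Proof.
move=> sZ j; have dZ := smooth_fun_diff (smooth_comp j sZ).
exact: (dir_deriv_comp si 0 dZ).1.
Qed.

(** The components of Z o i are those of Z composed with i, so the chain rule
    turns the definition of the left-hand side into the frame expansion of the
    right-hand side. *)
Lemma cov_along_restrict p (v : tangent p) (Z : forall y : N, tangent y) :
  smooth_field_at Z (i p) ->
  cov_along nabla i p v (fun q => Z (i q)) = nabla (i p) (tangent_map i p v) Z.
Proof.
move=> sZ; rewrite conn_coord //; apply: eq_bigr => j _; congr (_ *: _ + _).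
exact: (dir_deriv_comp si v (smooth_fun_diff (smooth_comp j sZ))).2.
Qed.

(** The product rule for phi applied to V.  The derivative of phi is tensorial
    in its field argument, but V need not extend to the ambient manifold, so
    the term (nabla phi) V is written as a sum over the coordinate frame.
    Proof: near p, phi V = V^j phi (E_j), and each phi (E_j) is the restriction
    of an ambient field. *)
Lemma cov_along_tensor11 (phi : tensor11 N) p (v : tangent p) V : diff_along V p ->
  cov_along nabla i p v (fun q => phi (i q) (V q)) =
  phi (i p) (cov_along nabla i p v V) +
  \sum_j comp_at (i p) (i p) (V p) 0 j *:
    cov_deriv11 nabla phi (i p) (tangent_map i p v) (coord_field (i p) j).
Proof.
move=> dV; pose E j y := phi y (coord_field (i p) j y).
have sE j : smooth_field_at (E j) (i p).
  exact/tensor11_smooth/smooth_coord_field.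
have dE j := diff_along_restrict (sE j).
have -> : cov_along nabla i p v (fun q => phi (i q) (V q)) =
    cov_along nabla i p v (fun q => \sum_j comp_along p V j q *: E j (i q)).
  apply: cov_along_near_eq; apply: filterS (near_cdom_map p) => q ipq.
  rewrite -[V q in LHS](sum_comp_coord _ ipq) linear_sum; apply: eq_bigr => j _.
  by rewrite linearZ.
rewrite (cov_along_sum _ v (fun j => diff_alongZ (dV j) (dE j))).2.
rewrite linear_sum -big_split; apply: eq_bigr => j _ /=.
rewrite (cov_alongZ v (dV j) (dE j)) cov_along_restrict // linearD !linearZ /=.
by rewrite -addrA -scalerDr /cov_deriv11 [phi _ _ + _]addrCA subrr addr0.
Qed.

Lemma diff_along_tangent_map p (Y : forall q : M, tangent q) :
  smooth_field_at Y p -> diff_along (fun q => tangent_map i q (Y q)) p.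
Proof. by move=> sY j; exact: diff_comp_tangent_map. Qed.

End fields_along.

(** * The structure vector field of a Lorentzian para-Sasakian manifold *)

Section para_sasakian.
Context {R : realType} {n : nat} {N : manifold R n}.
Context {phi : tensor11 N} {xi : vfield N} {eta : form1 N}.
Context {g : sym_tensor02 N} {nabla : connection N}.
Hypothesis lps : lorentzian_para_sasakian phi xi eta g nabla.

Lemma eta_xi p : eta p (xi p) = -1.
Proof.
have [[[xi0 phixi phi2] _ _ _] _ _] := lps.
have /eqP := phi2 p (xi p).
rewrite phixi linear0 -[X in _ == X + _]scale1r -scalerDl eq_sym.
rewrite scaler_eq0 (negbTE (xi0 p)) orbF.
by rewrite addrC addr_eq0 => /eqP.
Qed.

(** The function g (xi, xi) = eta (xi) is the constant -1, so its derivative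
    2 g (nabla_v xi, xi) vanishes. *)
Lemma eta_conn_xi p (v : tangent p) : eta p (nabla p v xi) = 0.
Proof.
have [[_ _ gxi _] [_ /(_ p v xi xi) gnabla] _] := lps.
have := gnabla (vfield_smooth _ xi p) (vfield_smooth _ xi p).
have -> : (fun q => g q (xi q) (xi q)) = fun=> -1.
  by apply/funext => q; rewrite gxi eta_xi.
rewrite dir_deriv_cst [X in _ = _ + X]tensor02_sym !gxi -mulr2n => /eqP.
by rewrite eq_sym mulrn_eq0 => /eqP.
Qed.

(** As phi xi = 0, the para-Sasakian identity for the field xi reads
    - phi (nabla_v xi) = - v - eta (v) xi.  Applying phi once more determines
    nabla_v xi up to its xi-component, which is zero by [eta_conn_xi]. *)
Lemma conn_xi p (v : tangent p) : nabla p v xi = phi p v.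
Proof.
have [[[_ phixi phi2] _ gxi _] _ nphi] := lps.
have phi_nabla : phi p (nabla p v xi) = v + eta p v *: xi p.
  have := nphi p v xi (vfield_smooth _ xi p).
  rewrite /cov_deriv11 (_ : (fun q => phi q (xi q)) = (fun q => 0)); last first.
    by apply: functional_extensionality_dep => q; exact: phixi.
  rewrite conn0 sub0r gxi eta_xi => /eqP; rewrite eqr_oppLR => /eqP ->.
  rewrite mulrN1 scaleN1r scaleNr mulr_natl mulr2n scalerDl.
  by rewrite !opprD !opprK addrA subrK.
have := phi2 p (nabla p v xi).
by rewrite eta_conn_xi scale0r addr0 phi_nabla linearD linearZ /= phixi scaler0 addr0.
Qed.

End para_sasakian.

(** * The induced structure on the hypersurface *)

Section hypersurface.
Context {R : realType} {n : nat} {N : manifold R n.+1} {M : manifold R n}.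
Context {phi : tensor11 N} {xi : vfield N} {eta : form1 N}.
Context {g : sym_tensor02 N} {nablabar : connection N}.
Context {i : M -> N} {J : tensor11 M} {alpha : form1 M}.
Context {nabla : connection M} {h : sym_tensor02 M}.
Hypothesis lps : lorentzian_para_sasakian phi xi eta g nablabar.
Hypothesis si : smooth_map i.
Hypothesis inj_i : forall p, injective (tangent_map i p).
Hypothesis xi_i : nowhere_tangent i xi.
Hypothesis JP : induced_structure i phi xi J alpha.
Hypothesis nablaP : induced_connection nablabar i xi nabla h.

(** If a <> b, dividing i_* (u - w) = (b - a) xi by b - a would make xi
    tangent to the hypersurface. *)
Lemma tangent_xi_decomp p (u w : tangent p) (a b : R) :
  tangent_map i p u + a *: xi (i p) = tangent_map i p w + b *: xi (i p) ->
  u = w /\ a = b.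
Proof.
move=> uw.
have ba : (b - a) *: xi (i p) = tangent_map i p (u - w).
  rewrite [RHS]linearB /= scalerBl; apply/eqP.
  by rewrite subr_eq addrAC uw [X in X - _]addrC addrK.
have [ab|ab] := eqVneq a b.
  by split=> //; apply: (@inj_i p); move: uw; rewrite ab => /addIr.
case: (@xi_i p ((b - a)^-1 *: (u - w))).
rewrite [LHS]linearZ /= -[X in _ *: X]/(tangent_map i p (u - w)) -ba.
by rewrite scalerA mulVf ?scale1r// subr_eq0 eq_sym.
Qed.

Lemma phi_decomp p (u : tangent p) (a : R) :
  phi (i p) (tangent_map i p u + a *: xi (i p)) =
  tangent_map i p (J p u) + alpha p u *: xi (i p).
Proof.
have [[[_ phixi _] _ _ _] _ _] := lps.
by rewrite linearD linearZ /= phixi scaler0 addr0 JP.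
Qed.

(** Compare the xi-components of phi (phi (i_* v)) computed from the induced
    structure and from phi^2 = I + eta (x) xi. *)
Lemma alpha_J p (v : tangent p) : alpha p (J p v) = eta (i p) (tangent_map i p v).
Proof.
have [[[_ _ phi2] _ _ _] _ _] := lps.
have := phi2 (i p) (tangent_map i p v).
by rewrite JP phi_decomp => /tangent_xi_decomp[].
Qed.

(** The tangential part of the derivative of phi (i_* Y) = i_* (J Y) +
    alpha (Y) xi. *)
Lemma cov_deriv_induced p (v : tangent p) (Y : forall q : M, tangent q) :
  smooth_field_at Y p ->
  cov_deriv11 nabla J p v Y =
  alpha p (J p (Y p)) *: v - alpha p (Y p) *: J p v.
Proof.
move=> sY; have [_ _ nphi] := lps.
have sJY := tensor11_smooth _ J _ _ sY.
have dY := diff_along_tangent_map si sY.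
have dJY := diff_along_tangent_map si sJY.
have daY := smooth_fun_diff (form1_smooth _ alpha _ _ sY).
have sxi := vfield_smooth _ xi (i p).
have dxi := diff_along_restrict si sxi.
have := cov_along_tensor11 nablabar si phi v dY.
have -> : (fun q => phi (i q) (tangent_map i q (Y q))) =
    (fun q => tangent_map i q (J q (Y q)) + alpha q (Y q) *: xi (i q)).
  by apply: functional_extensionality_dep => q; exact: JP.
rewrite (cov_alongD _ v dJY (diff_alongZ daY dxi)) (cov_alongZ _ v daY dxi).
rewrite (cov_along_restrict _ si v sxi) (conn_xi lps) JP.
rewrite (nablaP v sJY) (nablaP v sY) phi_decomp.
set w := tangent_map i p v; set V := tangent_map i p (Y p).
(* The sum over the frame contracts to (nabla phi) V by linearity in V.  The
   coefficient of xi is left uncontracted, since only the tangential parts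
   are compared below. *)
have -> : \sum_j comp_at (i p) (i p) V 0 j *:
    cov_deriv11 nablabar phi (i p) w (coord_field (i p) j) =
  eta (i p) V *: w + (\sum_j comp_at (i p) (i p) V 0 j *
    (g (i p) w (coord_field (i p) j (i p)) +
     2 * eta (i p) w * eta (i p) (coord_field (i p) j (i p)))) *: xi (i p).
  rewrite -{2}(sum_comp_coord V (chart_at_dom (i p))) linear_sum !scaler_suml.
  rewrite -big_split; apply: eq_bigr => j _ /=.
  rewrite nphi; last exact: smooth_coord_field.
  by rewrite linearZ /= -addrA -scalerDl scalerDr !scalerA.
set b := \sum_j _.
rewrite -alpha_J.
set dalpha := dir_deriv _ p v => eqn.
have /tangent_xi_decomp[] : tangent_map i p
      (nabla p v (fun q => J q (Y q)) + alpha p (Y p) *: J p v) +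
    (h p v (J p (Y p)) + dalpha + alpha p (Y p) * alpha p v) *: xi (i p) =
  tangent_map i p (J p (nabla p v Y) + alpha p (J p (Y p)) *: v) +
    (alpha p (nabla p v Y) + b) *: xi (i p).
  rewrite !(tangent_mapD, tangent_mapZ) !scalerDl -scalerA.
  move: eqn; rewrite scalerDr [dalpha *: _ + _]addrCA addrACA => eqn.
  by rewrite -[X in _ + X]addrA eqn addrACA.
move=> nablaJ _; apply/eqP.
by rewrite /cov_deriv11 subr_eq addrAC eq_sym subr_eq nablaJ addrC.
Qed.

End hypersurface.

Theorem corollary5p6 (R : realType) (n : nat)
    (Mbar : manifold R n.+1) (phi : tensor11 Mbar) (xi : vfield Mbar)
    (eta : form1 Mbar) (g : sym_tensor02 Mbar) (nablabar : connection Mbar)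
    (M : manifold R n) (i : M -> Mbar) (J : tensor11 M) (alpha : form1 M)
    (nabla : connection M) (h : sym_tensor02 M) :
  lorentzian_para_sasakian phi xi eta g nablabar ->
  smooth_embedding i ->
  nowhere_tangent i xi ->
  induced_structure i phi xi J alpha ->
  noninvariant alpha ->
  induced_connection nablabar i xi nabla h ->
  (parallel11 nabla J <->
   forall (X Y : vfield M) (p : M),
     alpha p (Y p) *: J p (X p) = alpha p (J p (Y p)) *: X p).
Proof.
move=> lps [si inj_i _ _] xi_i JP _ nablaP.
have nablaJ (X Y : vfield M) p : cov_deriv11 nabla J p (X p) Y =
    alpha p (J p (Y p)) *: X p - alpha p (Y p) *: J p (X p).
  exact (cov_deriv_induced lps si inj_i xi_i JP nablaP (X p) (vfield_smooth _ Y p)).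
split=> [Jpar X Y p|JX X Y p]; last by rewrite nablaJ JX subrr.
by apply/esym/eqP; rewrite -subr_eq0 -nablaJ Jpar.
Qed.
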